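(* Let $H$ be a hyperplane of $\mathfrak{A}$. (1) The relation $\sigma^{\mathsf{t}}_H$ on points defined by $p_1\,\sigma^{\mathsf{t}}_H\,p_2\iff \mathbf{L}_{\mathsf{t}}(p_1,p_2)=H$ is not a function (from the point set to itself); nevertheless, whenever $p_1\,\sigma^{\mathsf{t}}_H\,p_2$ holds, the translation which maps $p_1$ onto $p_2$ is a subset of $\sigma^{\mathsf{t}}_H$ (i.e. $x\,\sigma^{\mathsf{t}}_H\,(x+(p_2-p_1))$ for every point $x$). (2) The relation $\sigma^{\mathsf{m}}_H$ on points defined by $p_1\,\sigma^{\mathsf{m}}_H\,p_2\iff \mathbf{L}_{\mathsf{m}}(p_1,p_2)=H$ is either void or it is the central symmetry of $\mathfrak{A}$ with the centre $p_1\oplus p_2$ (where $p_1,p_2$ is any pair with $p_1\,\sigma^{\mathsf{m}}_H\,p_2$).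
   Context: Let $F$ be a commutative field with $\mathrm{char}(F)\neq2$, $m\geq2$, and let $V=F^{2m-2}$ with a nondegenerate symplectic form $\eta$. Let $Y=F\oplus V$, with vectors written $[a,u]$, and let $\mathfrak{A}$ be the affine space over $Y$ (points: vectors of $Y$; lines: cosets of 1-dimensional subspaces). Put $\rho([a_1,u_1],[a_2,u_2])=\eta(u_1,u_2)-(a_1-a_2)$. For points put $p_1p_2\equiv p_3p_4$ iff $\rho(p_1,p_2)=\rho(p_3,p_4)$, and define the bisectors $\mathbf{L}_{\mathsf{t}}(p_1,p_2)=\{p: p_1p\equiv p_2p\}$ and $\mathbf{L}_{\mathsf{m}}(p_1,p_2)=\{p: p_1p\equiv pp_2\}$. The affine midpoint is $p_1\oplus p_2=\frac12(p_1+p_2)$; the central symmetry with centre $c$ is $x\mapsto 2c-x$. *)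

(* Defs.v *)
From mathcomp Require Import all_boot all_order all_algebra.
From mathcomp Require Export sesquilinear.

Set Implicit Arguments.
Unset Strict Implicit.
Unset Printing Implicit Defensive.

Import GRing.Theory.
Local Open Scope ring_scope.

(* The vectors [a, u] of Y = F (+) V are the pairs (a, u). The factor F is
   written F^o, F seen as a vector space over itself, so that Y is a vectType. *)
Definition points (F : fieldType) (V : vectType F) : vectType F :=
  (F^o * V)%type.

Definition rho (F : fieldType) (V : vectType F) (eta : V -> V -> F)
    (p1 p2 : points V) : F :=
  eta p1.2 p2.2 - ((p1.1 : F) - (p2.1 : F)).

Definition equidistant (F : fieldType) (V : vectType F) (eta : V -> V -> F)
    (p1 p2 p3 p4 : points V) : bool :=
  rho eta p1 p2 == rho eta p3 p4.

Definition Lt (F : fieldType) (V : vectType F) (eta : V -> V -> F)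
    (p1 p2 : points V) : {pred points V} :=
  [pred p | equidistant eta p1 p p2 p].

Definition Lm (F : fieldType) (V : vectType F) (eta : V -> V -> F)
    (p1 p2 : points V) : {pred points V} :=
  [pred p | equidistant eta p1 p p p2].

Definition hyperplane (F : fieldType) (Y : vectType F) (H : {pred Y}) : Prop :=
  exists (q : Y) (W : {vspace Y}),
    (\dim W).+1 = \dim {:Y} /\ H =i [pred p | p - q \in W].

Definition sigma_t (F : fieldType) (V : vectType F) (eta : V -> V -> F)
    (H : {pred points V}) (p1 p2 : points V) : Prop :=
  Lt eta p1 p2 =i H.

Definition sigma_m (F : fieldType) (V : vectType F) (eta : V -> V -> F)
    (H : {pred points V}) (p1 p2 : points V) : Prop :=
  Lm eta p1 p2 =i H.

Definition midpoint (F : fieldType) (Y : vectType F) (p1 p2 : Y) : Y :=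
  2^-1 *: (p1 + p2).

Definition translation (F : fieldType) (Y : vectType F) (v x : Y) : Y := x + v.

Definition central_symmetry (F : fieldType) (Y : vectType F) (c x : Y) : Y :=
  2 *: c - x.

(* "A function from X to itself" is total: the empty relation on a nonempty X
   is not functional. *)
Definition functional (X : Type) (r : X -> X -> Prop) : Prop :=
  forall x, exists! y, r x y.

Definition empty_relation (X : Type) (r : X -> X -> Prop) : Prop :=
  forall x y, ~ r x y.

Definition is_graph_of (X : Type) (r : X -> X -> Prop) (f : X -> X) : Prop :=
  forall x y, r x y <-> y = f x.

(* Main.v *)
Require Import Defs.
From mathcomp Require Import all_boot all_order all_algebra.
From mathcomp Require Import ring.
From Stdlib Require Import Classical.

(** With [p_i = [a_i, u_i]] and [p = [a, u]],
    [p \in Lt p1 p2] iff [eta (u1 - u2) u = a1 - a2], and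
    [p \in Lm p1 p2] iff [eta (u1 + u2) u + 2 a = a1 + a2].
    So [Lt p1 p2] depends on [p1 - p2] only, and is moreover unchanged when
    this difference is doubled; hence no point has exactly one
    [sigma_t]-image. Likewise [Lm p1 p2] depends on [p1 + p2] only, and by
    nondegeneracy it determines [p1 + p2], so the [sigma_m]-images of [x] are
    just [p1 + p2 - x]. *)

Import GRing.Theory.
Local Open Scope ring_scope.

Section Bisectors.
Variables (F : fieldType) (V : vectType F) (eta : {skew_symmetric V}).
Implicit Types (p q : points V) (H : {pred points V}).

Lemma skewC u v : eta u v = - eta v u.
Proof. by rewrite hermC expr1 mulN1r. Qed.

Lemma Lt_difference p1 p2 p :
  (p \in Lt eta p1 p2) = (eta (p1 - p2).2 p.2 == (p1 - p2).1).
Proof.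
rewrite inE /equidistant /rho linearBl -[LHS]subr_eq0 -[RHS]subr_eq0 /=.
by congr (_ == 0); ring.
Qed.

(** Skew-symmetry turns [eta p.2 p2.2] into [- eta p2.2 p.2], so the two form values combine into
    one linear in [p1 + p2]. *)
Lemma Lm_sum p1 p2 p :
  (p \in Lm eta p1 p2) = (eta (p1 + p2).2 p.2 + 2 * p.1 == (p1 + p2).1).
Proof.
rewrite inE /equidistant /rho linearDl (skewC p.2) -[LHS]subr_eq0.
rewrite -[RHS]subr_eq0 /=.
by congr (_ == 0); ring.
Qed.

Lemma nondegenerate_eq0 (u : V) :
  nondegenerate eta -> (forall v, eta u v = 0) -> u = 0.
Proof.
by move=> /eqP rad0 u0; apply/eqP; rewrite -memv0 -rad0; apply/mem_orthovP.
Qed.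

(** Over each [u] a bisector has exactly one point, with first coordinate [(s.1 - eta s.2 u) / 2]
    for [s] the sum of the two points. Equal bisectors thus give equal values for all [u]: [u = 0]
    yields the first coordinates of the sums, nondegeneracy the second. *)
Lemma Lm_inj p1 p2 q1 q2 : 2 != 0 :> F -> nondegenerate eta ->
  Lm eta p1 p2 =i Lm eta q1 q2 -> p1 + p2 = q1 + q2.
Proof.
move=> two_neq0 nondeg eqL.
have onL (s : points V) u :
    eta s.2 u + 2 * ((s.1 - eta s.2 u) / 2 : F) = s.1 by field.
have eqs u : eta (q1 + q2).2 u - (q1 + q2).1
           = eta (p1 + p2).2 u - (p1 + p2).1.
  have := eqL ((((p1 + p2).1 - eta (p1 + p2).2 u) / 2 : F), u).
  rewrite !Lm_sum [X in X == _]onL eqxx => /esym/eqP /= <-.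
  by field.
have eq1 : (p1 + p2).1 = (q1 + q2).1.
  by have := eqs 0; rewrite !linear0r !sub0r => /oppr_inj.
rewrite [LHS]surjective_pairing [RHS]surjective_pairing eq1; congr pair.
apply/subr0_eq/nondegenerate_eq0 => // u.
by rewrite linearBl /=; move: (eqs u); rewrite eq1 => /addIr ->; rewrite subrr.
Qed.

Lemma hyperplane_proper (Y : vectType F) (K : {pred Y}) :
  hyperplane K -> ~ K =i predT.
Proof.
move=> [q [W [dimW KW]]] Kfull; suff WT : W = fullv.
  by move: dimW; rewrite WT => /eqP; rewrite eqn_leq ltnn.
apply/vspaceP => y; rewrite memvf.
by have := Kfull (y + q); rewrite KW !inE addrK.
Qed.

Lemma sigma_t_translation H p1 p2 x :
  sigma_t eta H p1 p2 -> sigma_t eta H x (translation (p2 - p1) x).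
Proof.
move=> st p; rewrite -(st p) !Lt_difference /translation.
by rewrite opprD addNKr opprB.
Qed.

(** Doubling [v] multiplies both sides of the equation of the bisector by 2, which is invertible. *)
Lemma sigma_t_double H x v : 2 != 0 :> F ->
  sigma_t eta H x (x + v) -> sigma_t eta H x (x + 2 *: v).
Proof.
move=> two_neq0 st p; rewrite -(st p) !Lt_difference !opprD !addNKr -scalerN /=.
rewrite linearZl_LR /=.
exact: (inj_eq (mulfI two_neq0)).
Qed.

Lemma sigma_t_not_functional H : 2 != 0 :> F -> hyperplane H ->
  ~ functional (sigma_t eta H).
Proof.
move=> two_neq0 /hyperplane_proper Hproper /(_ 0) [y [sty uniqy]].
(* The image [y] of the origin is its own translation vector, so [2 *: y] is a second image.
   Uniqueness forces [y = 0], but [Lt eta 0 0] is the whole space. *)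
have eqy : y = 2 *: y.
  apply: uniqy; rewrite -[2 *: y]add0r.
  by apply: sigma_t_double; rewrite ?add0r.
have y0 : y = 0 by apply: (@addrI _ y); rewrite addr0 -mulr2n -scaler_nat.
apply: Hproper => p.
by rewrite -(sty p) Lt_difference y0 subr0 linear0l eqxx.
Qed.

Lemma double_midpoint (Y : vectType F) (y1 y2 : Y) : 2 != 0 :> F ->
  2 *: midpoint y1 y2 = y1 + y2.
Proof. by move=> two_neq0; rewrite /midpoint scalerA divff ?scale1r. Qed.

Lemma sigma_m_graph H p1 p2 : 2 != 0 :> F -> nondegenerate eta ->
  sigma_m eta H p1 p2 ->
  is_graph_of (sigma_m eta H) (central_symmetry (midpoint p1 p2)).
Proof.
move=> two_neq0 nondeg sm x y; rewrite /central_symmetry double_midpoint //.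
split=> [smxy | -> p].
  have -> : p1 + p2 = x + y by apply: Lm_inj => // p; rewrite sm smxy.
  by rewrite addrC addKr.
by rewrite -(sm p) !Lm_sum [x + _]addrC subrK.
Qed.

End Bisectors.

Theorem theorem3p15 (F : fieldType) (char_neq2 : 2%N \notin [pchar F])
    (m : nat) (m_ge2 : (2 <= m)%N)
    (eta : {skew_symmetric 'rV[F]_(2 * m - 2)}) (eta_sympl : is_psymplectic eta)
    (H : {pred points 'rV[F]_(2 * m - 2)}) (H_hyp : hyperplane H) :
  (~ functional (sigma_t eta H) /\
   forall p1 p2, sigma_t eta H p1 p2 ->
     forall x, sigma_t eta H x (translation (p2 - p1) x)) /\
  (empty_relation (sigma_m eta H) \/
   ((exists p1 p2, sigma_m eta H p1 p2) /\
    forall p1 p2, sigma_m eta H p1 p2 ->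
      is_graph_of (sigma_m eta H) (central_symmetry (midpoint p1 p2)))).
Proof.
(* As 2 is prime, membership in [[pchar F]] computes to [2 = 0] in [F]. *)
have two_neq0 : 2 != 0 :> F by exact: char_neq2.
case: eta_sympl => nondeg _ _.
split; first split.
- exact: sigma_t_not_functional.
- by move=> p1 p2 st x; apply: sigma_t_translation.
have [ne | empty] := classic (exists p1 p2, sigma_m eta H p1 p2).
  by right; split=> // p1 p2; apply: sigma_m_graph.
by left=> p1 p2 sm; apply: empty; exists p1, p2.
Qed.
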